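(* Let $n\ge1$, let $\mathbf{D}=(D_1,\dots,D_L)$ be a bosonic multiline queue on $L$ rows and $n$ sites (of type $(\alpha,n)$ for an arbitrary weak composition $\alpha$ with $L$ parts), and let $1\le i<L$. Then $$\widetilde{\Phi}\bigl(\sigma_i(\mathbf{D})\bigr)=\widetilde{\Phi}(\mathbf{D}).$$
   Context: Fix $n\ge1$, $[n]=\{1,\dots,n\}$; sites are considered cyclically (in $\mathbb{Z}/n\mathbb{Z}$). $\mathcal{M}(n)$ is the set of finite multisets with entries in $[n]$. A bosonic multiline queue of type $(\alpha,n)$, $\alpha=(\alpha_1,\dots,\alpha_L)$ a sequence of nonnegative integers, is a tuple $\mathbf{D}=(D_1,\dots,D_L)$ with $D_j\in\mathcal{M}(n)$, $|D_j|=\alpha_j$ (row 1 is the bottom row; multiplicity of $j$ in $D_i$ = number of particles at site $j$ of row $i$). $\widetilde{\mathcal{W}}$ is the set of words $(A_1,\dots,A_n)$ of finite multisets of positive integers. Pairing. For $A,B\in\mathcal{M}(n)$ ($A$ the lower row, $B$ the upper row), $\mathrm{cpair_b}(A,B)$ is: for $j=1,\dots,n$ in order, write '')'' once for each instance of $j$ in $B$ and then ''('' once for each instance of $j$ in $A$; view the bracket word on a circle and recursively match each ''('' with a '')'' following it cyclically when there are no unmatched brackets between them. A particle of $A$ or $B$ is paired (unpaired) if its bracket is matched (unmatched); particles are counted with multiplicity at each site. Involution $\sigma_i$: acts on $\mathbf{D}$ by moving all particles unpaired in $\mathrm{cpair_b}(D_i,D_{i+1})$ from row $i$ to row $i+1$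 and from row $i+1$ to row $i$ (keeping their sites). Operators $D^{(\ell)}$. For $D\in\mathcal{M}(n)$, $\ell\ge1$ and $\widetilde{\mathbf{u}}=(\widetilde u_1,\dots,\widetilde u_n)\in\widetilde{\mathcal{W}}$ with $\ell<\min\bigcup_i\widetilde u_i$, define $D^{(\ell)}(\widetilde{\mathbf{u}})=(Y_1,\dots,Y_n)\in\widetilde{\mathcal{W}}$ as follows. Initialize all $Y_j=\emptyset$. Let $a=\min\bigcup_i\widetilde u_i$, $K=\max\bigcup_i\widetilde u_i$, and let $\widetilde u^{(r)}\in\mathcal{M}(n)$ be the multiset in which $j$ has multiplicity equal to the number of elements $\ge r$ of $\widetilde u_j$. Pairing phase: let $s$ be the maximal $r\in\{a,\dots,K\}$ with $|\widetilde u^{(r)}|\ge|D|$, if it exists, and $s=a$ otherwise. For $r=K,K-1,\dots,s$: for each newly paired particle of $D$ at site $j$, add an element $r$ to $Y_j$ (the number of newly paired particles at site $j$ is the number of particles of $D$ at $j$ paired in $\mathrm{cpair_b}(D,\widetilde u^{(r)})$ minus the number paired in $\mathrm{cpair_b}(D,\widetilde u^{(r+1)})$). Then for each particle of $D$ unpaired in $\mathrm{cpair_b}(D,\widetilde u^{(s)})$, at site $j$ say, add an element $\ell$ to $Y_j$. Collapsing phase: for $r=s,s-1,\dots,a$: for each newly unpaired particle of $\widetilde u^{(r)}$ at site $j$, add an element $r-1$ to $Y_j$ (the number of newly unpaired particles at $j$ is the number of particles of $\widetilde u^{(r)}$ at $j$ unpaired in $\mathrm{cpair_b}(D,\widetilde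 u^{(r)})$ minus the number of particles of $\widetilde u^{(r+1)}$ at $j$ unpaired in $\mathrm{cpair_b}(D,\widetilde u^{(r+1)})$). For the empty word $\widetilde{\mathbf{w}}_0=(\emptyset,\dots,\emptyset)$, $D^{(\ell)}(\widetilde{\mathbf{w}}_0)$ has at site $j$ the multiset consisting of $\ell$ repeated as many times as $j$ occurs in $D$. Projection: $\widetilde\Phi(\mathbf{D})=D_1^{(1)}\bigl(D_2^{(2)}(\cdots D_L^{(L)}(\widetilde{\mathbf{w}}_0)\cdots)\bigr)$. *)

(* Defs.v *)
From mathcomp Require Import all_boot.
From mathcomp Require Export finmap multiset.

Set Implicit Arguments.
Unset Strict Implicit.
Unset Printing Implicit Defensive.

Local Open Scope mset_scope.
Local Open Scope nat_scope.

(* Sites are 'I_n, i.e. site j of [n] = {1, ..., n} is the ordinal j - 1.     *)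

(* Bracket words: (true, x) is "(" and (false, x) is ")", carried by x.       *)
Section CyclicMatching.
Variable T : Type.
Implicit Types w : seq (bool * T).

Definition head_match w : bool :=
  if w is (true, _) :: (false, _) :: _ then true else false.

(* A word on a circle is taken up to rotation: rot p w reads it from          *)
(* position p.  One step matches, and erases, the first "(" that is followed  *)
(* cyclically by ")" among the brackets not matched yet.  The set of          *)
(* brackets that eventually get matched is independent of the order chosen.   *)
Definition match_step w :=
  let p := find (fun p => head_match (rot p w)) (iota 0 (size w)) in
  if p < size w then drop 2 (rot p w) else w.

(* Each effective step erases two brackets, so size w steps are enough.       *)
Definition unmatched w := iter (size w) match_step w.

End CyclicMatching.

Section MultilineQueues.
Variable n : nat.
Implicit Types A B : {mset 'I_n}.

(* A is the lower row and B the upper row.                                    *)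
Definition cpair_b A B : seq (bool * 'I_n) :=
  flatten [seq nseq (B j) (false, j) ++ nseq (A j) (true, j) | j <- enum 'I_n].

Definition unpaired_lower A B : {mset 'I_n} :=
  seq_mset [seq b.2 | b <- unmatched (cpair_b A B) & b.1].

Definition unpaired_upper A B : {mset 'I_n} :=
  seq_mset [seq b.2 | b <- unmatched (cpair_b A B) & ~~ b.1].

Definition paired_lower A B : {mset 'I_n} := A `\` unpaired_lower A B.

(* Row i (1 <= i <= L, row 1 at the bottom) is the entry of index i - 1.      *)
Definition bmlq (L : nat) := L.-tuple {mset 'I_n}.

Definition row L (D : bmlq L) (i : nat) : {mset 'I_n} := nth mset0 D i.-1.

Definition has_type L (alpha : L.-tuple nat) (D : bmlq L) : Prop :=
  forall k : 'I_L, size (tnth D k) = tnth alpha k.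

Definition sigma L (i : nat) (D : bmlq L) : bmlq L :=
  let A := row D i in
  let B := row D i.+1 in
  let uA := unpaired_lower A B in
  let uB := unpaired_upper A B in
  [tuple if k.+1 == i then (A `\` uA) `+` uB
         else if k.+1 == i.+1 then (B `\` uB) `+` uA
         else tnth D k | k < L].

(* The words (A_1, ..., A_n) of finite multisets; all the letters that occur  *)
(* below are positive.                                                        *)
Definition mword := {ffun 'I_n -> {mset nat}}.

Definition empty_word : mword := [ffun=> mset0].

Definition letters (u : mword) : seq nat :=
  flatten [seq (u j : seq nat) | j <- enum 'I_n].

Definition max_letter (u : mword) : nat := \max_(x <- letters u) x.

Definition min_letter (u : mword) : nat :=
  \big[minn/max_letter u]_(x <- letters u) x.

(* The multiset u^(r).                                                        *)
Definition level (u : mword) (r : nat) : {mset 'I_n} :=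
  seq_mset (flatten [seq nseq (count (leq r) (u j)) j | j <- enum 'I_n]).

(* D^(l)(u), meant for 0 < l < min_letter u, or 0 < l and u empty.  The       *)
(* truncated subtractions compare nested sets of particles.  Note that        *)
(* level u K.+1 is empty, and that s defaults to a.                           *)
Definition row_op (l : nat) (D : {mset 'I_n}) (u : mword) : mword :=
  if u == empty_word then [ffun j => msetn (D j) l] else
  let a := min_letter u in
  let K := max_letter u in
  let s := \big[maxn/a]_(a <= r < K.+1 | size D <= size (level u r)) r in
  let paired r := paired_lower D (level u r) in
  let unpaired r := unpaired_upper D (level u r) in
  [ffun j =>
    (\big[msetD/mset0]_(s <= r < K.+1) msetn (paired r j - paired r.+1 j) r)
    `+` msetn (unpaired_lower D (level u s) j) l
    `+` (\big[msetD/mset0]_(a <= r < s.+1)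
           msetn (unpaired r j - unpaired r.+1 j) r.-1)].

Definition Phi L (D : bmlq L) : mword :=
  foldr (fun lD u => row_op lD.1 lD.2 u) empty_word (zip (iota 1 L) D).

End MultilineQueues.

(* Main.v *)
Require Import Defs.
From mathcomp Require Import all_boot all_order all_algebra.
From mathcomp Require Import zify.

Set Implicit Arguments.
Unset Strict Implicit.
Unset Printing Implicit Defensive.

Import Order.TTheory GRing.Theory Num.Theory.
Local Open Scope ring_scope.

(** The involution sigma_i and the row operators only see two rows at a time
    through the exchange of a lower row A and an upper row B: A keeps its
    paired particles and receives the unpaired ones of B ([low A B]), and
    conversely ([up A B]).  On a circle every particle of the smaller row is
    paired.  This turns the definition of D^(l) into a short rule on the
    levels u^(r) of a word, which determine the word: the levels of D^(l)(u)
    are obtained from those of u, listed by decreasing size, by replacing every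
    level U by [low D U] and inserting D at the place given by its size
    ([level_row_op_insert]).
    Inserting B and then A therefore commutes with the exchange of A and B as
    soon as the exchange is an involution ([lowK]) and satisfies half of the
    Yang-Baxter equation, [low A (low B C) = low (low A B) (low (up A B) C)]
    ([low_yb]); this is [insert_exchange].

    Both facts are statements about last passage percolation.  Unroll the
    circle and describe a row by its [height], the number of its particles up
    to a given site.  The difference of the two heights has a running maximum
    over one period, the [crest], and the exchange adds the increments of the
    crest to A ([mcount_low]).  As a function of the height of B, the height of
    [low A B] is thus given by a max-plus linear operator [passage], and the
    composite of the operators of A and B is expressed by the largest weights
    of paths that follow B for a while and then turn to A.  Those weights do
    not change when A and B are exchanged ([path_weight_low_le],
    [path_weight_low_ge]), because a running maximum is a staircase whose
    corners lie on the function it dominates ([corner]).  With windows of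
    length n this gives the involution, and in general the Yang-Baxter
    identity.

    The crest formula for the exchange comes from the bracket matching itself:
    erasing a matched pair ( ... ) only raises the bottom of a valley of the
    profile by one, up to a global constant, so the increments of the crest are
    invariant ([excess_cons2]); once all brackets are of the same kind they can
    be read off directly ([excess_unmatched]). *)

(** * Height functions and their profiles *)

Definition height (a : nat -> int) k : int := \sum_(t < k) a t.

Lemma heightS a k : height a k.+1 = height a k + a k.
Proof. by rewrite /height big_ord_recr. Qed.

Lemma height0 a : height a 0 = 0.
Proof. by rewrite /height big_ord0. Qed.

Lemma eq_height a b k : a =1 b -> height a k = height b k.
Proof. by move=> ab; apply: eq_bigr => t _; rewrite ab. Qed.

Lemma height_mono a k l : (forall s, 0 <= a s) -> (k <= l)%N -> height a k <= height a l.
Proof.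
move=> a_ge0 /subnKC <-; elim: (l - k)%N => [|d IH]; first by rewrite addn0.
by rewrite addnS heightS; have := a_ge0 (k + d)%N; lia.
Qed.

Lemma height_const a k l : (forall s, (k <= s < l)%N -> a s = 0) -> (k <= l)%N ->
  height a l = height a k.
Proof.
move=> a0 /subnKC el; move: a0; rewrite -el; elim: (l - k)%N => [|d IH] a0; first by rewrite addn0.
rewrite addnS heightS IH => [|s hs]; last by apply: a0; lia.
by rewrite a0 ?addr0 //; lia.
Qed.

Lemma height_add a b c k : (forall s, c s = a s + b s) -> height c k = height a k + height b k.
Proof. by move=> e; rewrite /height -big_split; apply: eq_bigr => s _; rewrite e. Qed.

(** Here [a] counts opening and [b] closing brackets, and the closing
    brackets of a site come before its opening ones.  The value is the excess of
    closing brackets right between the two groups of site [k]. *)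
Definition profile a b k : int := height b k.+1 - height a k.

Lemma eq_profile a a' b b' k : a =1 a' -> b =1 b' -> profile a b k = profile a' b' k.
Proof. by move=> ha hb; rewrite /profile (eq_height _ ha) (eq_height _ hb). Qed.

(** Where no bracket remains strictly between [x] and [y], the profile can
    only drop when leaving [x] and only rise when reaching [y]. *)
Lemma profile_flat a b x y k : (forall s, 0 <= a s) -> (forall s, 0 <= b s) ->
  (forall s, (x < s < y)%N -> a s = 0 /\ b s = 0) -> (x < k < y)%N ->
  profile a b k <= profile a b x /\ profile a b k <= profile a b y.
Proof.
move=> a_ge0 b_ge0 ab0 hk; rewrite /profile.
have h1 : height b k.+1 = height b x.+1.
  by apply: height_const => [s hs|]; [have [] := ab0 s; lia|lia].
have h2 : height a y = height a k.
  by apply: height_const => [s hs|]; [have [] := ab0 s; lia|lia].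
have h3 : height a x <= height a k by apply: height_mono => //; lia.
have h4 : height b k.+1 <= height b y.+1 by apply: height_mono => //; lia.
lia.
Qed.

(** * Monotone staircases *)

(** A running maximum decreases by steps, and it steps down only at places where
    it equals the function below it.  The third clause names the last such
    place, after which the maximum keeps its final value. *)
Lemma corner (f m : nat -> int) p q : (p <= q)%N ->
  (forall k, (p <= k <= q)%N -> m k = Num.max (f k) (m k.+1)) ->
  [/\ forall k, (p <= k <= q)%N -> m q.+1 <= m k.+1 /\ m k <= m p,
      m p = m q.+1 \/ exists2 k, (p <= k <= q)%N & m p = f k &
      m p = m q.+1 \/ exists2 k, (p <= k <= q)%N & m k = f k /\ m k.+1 = m q.+1].
Proof.
move=> /subnKC <-; elim: (q - p)%N => [|d IH] hm.
  rewrite addn0 in hm *; have := hm p; split=> [k hk||].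
  - by have -> : k = p by lia.
  - by case: (leP (f p) (m p.+1)) => ?; [left|right; exists p]; lia.
  - by case: (leP (f p) (m p.+1)) => ?; [left|right; exists p; try split]; lia.
have [|h1 h2 h3] := IH; first by move=> k hk; apply: hm; lia.
rewrite addnS; set q' := (p + d)%N in h1 h2 h3 *.
have hq := hm q'.+1.
have mono k : (p <= k <= q'.+1)%N -> m q'.+2 <= m k.+1 /\ m k <= m p.
  have [hk|hk] := leqP k q'; first by have := h1 k; have := h1 q'; lia.
  move=> hk'; have -> : k = q'.+1 by lia.
  by have := h1 q'; have := hm q'; lia.
split=> //.
- case: h2 => [h2|[k hk e]]; last by right; exists k; lia.
  case: (leP (f q'.+1) (m q'.+2)) => ?; first by left; lia.
  by right; exists q'.+1; lia.
- case: (leP (f q'.+1) (m q'.+2)) => ?; last by right; exists q'.+1; try split; lia.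
  case: h3 => [h3|[k hk [e1 e2]]]; first by left; lia.
  by right; exists k; try split; lia.
Qed.

(** Either the maximum is constant on the interval, and the four values of
    [m] cancel, or [m p] is a value of [f] and monotonicity bounds the rest. *)
Lemma corner_le (f m : nat -> int) p q k :
  (forall k, (p <= k <= q)%N -> m k = Num.max (f k) (m k.+1)) ->
  (p <= k <= q)%N ->
  exists2 k', (p <= k' <= q)%N & f k + m p + m q.+1 - m k - m k.+1 <= f k'.
Proof.
move=> hm hk; have [|mono h _] := corner (p := p) (q := q) _ hm; first by lia.
have := mono k hk; have := hm k hk; case: h => [h|[k' hk' e]] ? ?.
  by exists k; lia.
by exists k'; lia.
Qed.

(** At the last corner of the staircase the expression on the right is [m p],
    the largest value of all; without a corner [m] is constant and [k] itself works. *)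
Lemma corner_ge (f m : nat -> int) p q k :
  (forall k, (p <= k <= q)%N -> m k = Num.max (f k) (m k.+1)) ->
  (p <= k <= q)%N ->
  exists2 k', (p <= k' <= q)%N & f k <= f k' + m p + m q.+1 - m k' - m k'.+1.
Proof.
move=> hm hk; have [|mono _ h] := corner (p := p) (q := q) _ hm; first by lia.
have := mono k hk; have := hm k hk; case: h => [h|[k' hk' e]] ? ?.
  by exists k; lia.
by exists k'; lia.
Qed.

(** * Sliding maxima and the exchange of two periodic rows *)

Section Window.
Variable n : nat.
Hypothesis n_gt0 : (0 < n)%N.
Implicit Types (f g : nat -> int) (i k : nat).

(** The maximum of [f] over the window of [n] consecutive integers from [i]; the
    first value is the base, since the integers have no least element. *)
Definition wmax f i : int :=
  iteri n.-1 (fun k m => Num.max m (f (i + k.+1)%N)) (f i).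

Lemma wmaxP f i :
  (forall k, (i <= k < i + n)%N -> f k <= wmax f i) /\
  (exists2 k, (i <= k < i + n)%N & wmax f i = f k).
Proof.
rewrite /wmax; have -> : (i + n = i + n.-1.+1)%N by rewrite prednK.
elim: n.-1 => [|m [IHle IHex]] /=.
  split=> [k hk|]; last by exists i; lia.
  by have -> : k = i by lia.
set m0 := iteri _ _ _ in IHle IHex *; split=> [k hk|].
  have [hkm|hkm] := ltnP k (i + m.+1); first by have := IHle k; lia.
  have -> : k = (i + m.+1)%N by lia.
  by lia.
have [k hk Mk] := IHex.
have [hle|hlt] := leP (f (i + m.+1)%N) m0; last by exists (i + m.+1)%N; lia.
by exists k; lia.
Qed.

Lemma wmax_ge f i k : (i <= k < i + n)%N -> f k <= wmax f i.
Proof. by case: (wmaxP f i) => + _; apply. Qed.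

Lemma wmax_ex f i : exists2 k, (i <= k < i + n)%N & wmax f i = f k.
Proof. by case: (wmaxP f i). Qed.

Lemma wmax_le f i m : (forall k, (i <= k < i + n)%N -> f k <= m) -> wmax f i <= m.
Proof. by have [k hk ->] := wmax_ex f i; apply. Qed.

Lemma wmax_shift f g i c (j : nat) :
  (forall k, (i <= k < i + n)%N -> g (k + j)%N = f k + c) ->
  wmax g (i + j) = wmax f i + c.
Proof.
move=> fg.
have h1 : wmax g (i + j) <= wmax f i + c.
  apply: wmax_le => k hk; have -> : k = (k - j + j)%N by lia.
  have hk' : (i <= k - j < i + n)%N by lia.
  by have := wmax_ge f hk'; rewrite fg; lia.
have h2 : wmax f i <= wmax g (i + j) - c.
  apply: wmax_le => k hk.
  have hk' : (i + j <= k + j < i + j + n)%N by lia.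
  by have := wmax_ge g hk'; rewrite fg; lia.
lia.
Qed.

Lemma wmax_addc f g i c :
  (forall k, (i <= k < i + n)%N -> g k = f k + c) -> wmax g i = wmax f i + c.
Proof.
move=> fg; rewrite -[i in LHS]addn0; apply: wmax_shift => k hk.
by rewrite addn0 fg.
Qed.

Lemma eq_wmax f g i : (forall k, (i <= k < i + n)%N -> f k = g k) -> wmax f i = wmax g i.
Proof. by move=> fg; rewrite (@wmax_addc g f i 0) ?addr0 // => k hk; rewrite fg ?addr0. Qed.

Definition periodic (a : nat -> int) := forall t, a (t + n)%N = a t.

Lemma height_periodic a : periodic a ->
  forall k, height a (k + n) = height a k + height a n.
Proof.
move=> pa; elim=> [|k IH]; first by rewrite height0 add0n add0r.
by rewrite addSn !heightS pa IH; lia.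
Qed.

Definition crest a b i : int := wmax (profile a b) i.
(** The exchange of two periodic rows, in a form that treats both
    orders of their sizes alike.  It is the combinatorial R-matrix of one-row
    affine crystals, written with a window maximum. *)
Definition lowz a b t : int := a t + crest a b t.+1 - crest a b t.
Definition upz a b t : int := a t + b t - lowz a b t.

Lemma eq_crest a a' b b' k : a =1 a' -> b =1 b' -> crest a b k = crest a' b' k.
Proof. by move=> ha hb; apply: eq_wmax => t _; apply: eq_profile. Qed.

Lemma eq_lowz a a' b b' : a =1 a' -> b =1 b' -> lowz a b =1 lowz a' b'.
Proof. by move=> ha hb t; rewrite /lowz !(eq_crest _ ha hb) ha. Qed.

Lemma crest_periodic a b : periodic a -> periodic b ->
  forall i, crest a b (i + n) = crest a b i + (height b n - height a n).
Proof.
move=> pa pb i; apply: wmax_shift => k _.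
by rewrite /profile -addSn !height_periodic //; lia.
Qed.

Lemma lowz_periodic a b : periodic a -> periodic b -> periodic (lowz a b).
Proof.
move=> pa pb t; rewrite /lowz pa.
by have := crest_periodic pa pb t; have := crest_periodic pa pb t.+1; rewrite -addSn; lia.
Qed.

Lemma upz_periodic a b : periodic a -> periodic b -> periodic (upz a b).
Proof. by move=> pa pb t; rewrite /upz pa pb lowz_periodic. Qed.

Lemma height_low a b i : height (lowz a b) i = height a i + crest a b i - crest a b 0.
Proof.
elim: i => [|i IH]; first by rewrite !height0; lia.
by rewrite !heightS IH /lowz; lia.
Qed.

Lemma height_up a b i : height (upz a b) i = height b i - crest a b i + crest a b 0.
Proof.
elim: i => [|i IH]; first by rewrite !height0; lia.
by rewrite !heightS IH /upz /lowz; lia.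
Qed.

(** Moving the window by one site loses the value at [i] and gains the value
    at [i + n], which is not larger when the second row is the smaller one. *)
Lemma crest_descent a b i : periodic a -> periodic b -> height b n <= height a n ->
  crest a b i = Num.max (profile a b i) (crest a b i.+1).
Proof.
move=> pa pb le_ba.
have [hm hn] : profile a b i <= crest a b i /\ profile a b (i + n) <= crest a b i.+1.
  by split; apply: wmax_ge; lia.
have ph : profile a b (i + n) = profile a b i + (height b n - height a n).
  by rewrite /profile -addSn !height_periodic //; lia.
have h1 : crest a b i <= Num.max (profile a b i) (crest a b i.+1).
  apply: wmax_le => k hk; have [->|ne] := eqVneq k i; first by lia.
  have /(wmax_ge (profile a b)) : (i.+1 <= k < i.+1 + n)%N by lia.
  by rewrite -/(crest a b i.+1); lia.
have h2 : crest a b i.+1 <= crest a b i.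
  apply: wmax_le => k hk; have [e|ne] := eqVneq k (i + n)%N; first by rewrite e ph; lia.
  by apply: wmax_ge; lia.
lia.
Qed.

Lemma crest_ascent a b i : periodic a -> periodic b -> height a n <= height b n ->
  crest a b i.+1 = Num.max (profile a b i + (height b n - height a n)) (crest a b i).
Proof.
move=> pa pb le_ab.
have [hm hn] : profile a b i <= crest a b i /\ profile a b (i + n) <= crest a b i.+1.
  by split; apply: wmax_ge; lia.
have ph : profile a b (i + n) = profile a b i + (height b n - height a n).
  by rewrite /profile -addSn !height_periodic //; lia.
have h1 : crest a b i.+1 <= Num.max (profile a b (i + n)) (crest a b i).
  apply: wmax_le => k hk; have [->|ne] := eqVneq k (i + n)%N; first by lia.
  have /(wmax_ge (profile a b)) : (i <= k < i + n)%N by lia.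
  by rewrite -/(crest a b i); lia.
have h2 : crest a b i <= crest a b i.+1.
  apply: wmax_le => k hk; have [e|ne] := eqVneq k i; first by rewrite e; lia.
  by apply: wmax_ge; lia.
lia.
Qed.

End Window.

(** * Exchanging two rows preserves last passage values *)

Section YangBaxter.
Variable n : nat.
Hypothesis n_gt0 : (0 < n)%N.
Local Notation wmax := (wmax n).
Local Notation crest := (crest n).
Local Notation lowz := (lowz n).
Local Notation upz := (upz n).
Local Notation periodic := (periodic n).

(** If the first row is the larger one, the crest is a descending staircase
    over the profile; otherwise it is an ascending one over the profile shifted
    by a period, and reading the interval backwards brings it to the same form. *)
Lemma turn_le a b p q k : periodic a -> periodic b -> (p <= k <= q)%N ->
  exists2 k', (p <= k' <= q)%N &
    profile a b k + crest a b p + crest a b q.+1 - crest a b k - crest a b k.+1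
      <= profile a b k'.
Proof.
move=> pa pb hk; case: (leP (height b n) (height a n)) => h.
  by apply: corner_le => // i _; apply: crest_descent.
set d := height b n - height a n.
pose f i := profile a b (p + q - i)%N + d; pose m i := crest a b (p + q.+1 - i)%N.
have [|| k' hk' e] := @corner_le f m p q (p + q - k)%N; [|lia|].
  move=> i hi; rewrite /m /f subnS addnS subSn; last by lia.
  by rewrite crest_ascent //; lia.
exists (p + q - k')%N; first by lia.
move: e; rewrite /f /m.
have -> : (p + q - (p + q - k) = k)%N by lia.
have -> : (p + q.+1 - p = q.+1)%N by lia.
have -> : (p + q.+1 - q.+1 = p)%N by lia.
have -> : (p + q.+1 - (p + q - k) = k.+1)%N by lia.
have -> : (p + q.+1 - (p + q - k).+1 = k)%N by lia.
lia.
Qed.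

Lemma turn_ge a b p q k : periodic a -> periodic b -> (p <= k <= q)%N ->
  exists2 k', (p <= k' <= q)%N &
    profile a b k <= profile a b k' + crest a b p + crest a b q.+1
      - crest a b k' - crest a b k'.+1.
Proof.
move=> pa pb hk; case: (leP (height b n) (height a n)) => h.
  by apply: corner_ge => // i _; apply: crest_descent.
set d := height b n - height a n.
pose f i := profile a b (p + q - i)%N + d; pose m i := crest a b (p + q.+1 - i)%N.
have [|| k' hk' e] := @corner_ge f m p q (p + q - k)%N; [|lia|].
  move=> i hi; rewrite /m /f subnS addnS subSn; last by lia.
  by rewrite crest_ascent //; lia.
exists (p + q - k')%N; first by lia.
move: e; rewrite /f /m.
have -> : (p + q - (p + q - k) = k)%N by lia.
have -> : (p + q.+1 - p = q.+1)%N by lia.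
have -> : (p + q.+1 - q.+1 = p)%N by lia.
have -> : (p + q.+1 - k' = (p + q - k').+1)%N by lia.
have -> : (p + q.+1 - k'.+1 = p + q - k')%N by lia.
lia.
Qed.

(** The weight of the lattice path that collects [b] from site [p] to site
    [k], turns, and collects [a] from site [k] to site [q - 1]. *)
Definition path_weight a b p q k := height b k.+1 - height b p + (height a q - height a k).

Lemma path_weight_low a b p q k :
  path_weight (lowz a b) (upz a b) p q k =
  height a q - height b p
    + (profile a b k + crest a b p + crest a b q - crest a b k - crest a b k.+1).
Proof. by rewrite /path_weight !height_low // !height_up // /profile; lia. Qed.

Lemma path_weight_low_le a b p q k : periodic a -> periodic b -> (p <= k < q)%N ->
  exists2 k', (p <= k' < q)%N &
    path_weight (lowz a b) (upz a b) p q k <= path_weight a b p q k'.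
Proof.
case: q => [|q] pa pb hk; first by lia.
have [k' hk' e] := turn_le pa pb hk; exists k' => //.
by rewrite path_weight_low /path_weight; rewrite /profile in e *; lia.
Qed.

Lemma path_weight_low_ge a b p q k : periodic a -> periodic b -> (p <= k < q)%N ->
  exists2 k', (p <= k' < q)%N &
    path_weight a b p q k <= path_weight (lowz a b) (upz a b) p q k'.
Proof.
case: q => [|q] pa pb hk; first by lia.
have [k' hk' e] := turn_ge pa pb hk; exists k' => //.
by rewrite path_weight_low /path_weight; rewrite /profile in e *; lia.
Qed.

(** The crest is the largest weight of a path across a full period, up to
    boundary heights, and these largest weights are preserved by the exchange. *)
Lemma crest_low a b i : periodic a -> periodic b ->
  crest (lowz a b) (upz a b) i = 2 * crest a b 0 - crest a b (i + n).
Proof.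
move=> pa pb; set a' := lowz a b; set b' := upz a b.
have E : crest a' b' i + height a' (i + n) - height b' i =
         crest a b i + height a (i + n) - height b i.
  have [k hk e] := wmax_ex n_gt0 (profile a b) i.
  have [k' hk' e'] := wmax_ex n_gt0 (profile a' b') i.
  have [l hl] := path_weight_low_le pa pb hk'; have [l' hl'] := path_weight_low_ge pa pb hk.
  have := wmax_ge n_gt0 (profile a b) hl; have := wmax_ge n_gt0 (profile a' b') hl'.
  rewrite -/(crest a b i) -/(crest a' b' i) -/a' -/b' in e e' *.
  by rewrite /path_weight; move: e e'; rewrite /profile; lia.
by move: E; rewrite /a' /b' height_low // height_up //; lia.
Qed.

Lemma lowzK a b : periodic a -> periodic b -> lowz (lowz a b) (upz a b) =1 a.
Proof.
move=> pa pb t; rewrite {1}/lowz !crest_low //.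
have := crest_periodic n_gt0 pa pb t; have := crest_periodic n_gt0 pa pb t.+1.
by rewrite /lowz; lia.
Qed.

Lemma upzK a b : periodic a -> periodic b -> upz (lowz a b) (upz a b) =1 b.
Proof. by move=> pa pb t; rewrite {1}/upz lowzK // /upz; lia. Qed.

(** The max-plus linear operator on heights that describes the exchange with
    [a] for a varying second row. *)
Definition passage a (f : nat -> int) i := height a i + wmax (fun k => f k.+1 - height a k) i.

Lemma eq_passage a a' f f' i : a =1 a' -> f =1 f' -> passage a f i = passage a' f' i.
Proof.
move=> ha hf; rewrite /passage (eq_height _ ha); congr (_ + _).
by apply: eq_wmax => // k _; rewrite hf (eq_height _ ha).
Qed.

Lemma lowz_passage a b t : lowz a b t = passage a (height b) t.+1 - passage a (height b) t.
Proof. by rewrite /passage heightS /lowz /crest /profile; lia. Qed.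

Lemma height_lowz_passage a b i :
  height (lowz a b) i = passage a (height b) i - passage a (height b) 0.
Proof. by rewrite height_low // /passage height0 /crest /profile; lia. Qed.

Lemma passage_subc a f c i : passage a (fun k => f k - c) i = passage a f i - c.
Proof.
rewrite /passage -addrA; congr (_ + _).
by apply: wmax_addc => // k _; lia.
Qed.

Lemma passage_ge a f i k : (i <= k < i + n)%N ->
  height a i + (f k.+1 - height a k) <= passage a f i.
Proof. by rewrite lerD2l; apply: (wmax_ge n_gt0 (fun k => f k.+1 - height a k)). Qed.

Lemma passage_ex a f i : exists2 k, (i <= k < i + n)%N &
  passage a f i = height a i + (f k.+1 - height a k).
Proof.
rewrite /passage.
by have [k hk ->] := wmax_ex n_gt0 (fun k => f k.+1 - height a k) i; exists k.
Qed.

(** Expand both operators: the left side is attained by a pair of turning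
    points [k < l <= k + n].  Together with the invariance of [a + b], it is the
    weight of a path of the exchanged rows, from [i] to [l] when [l] stays in
    the window and from [l - n] to [i + n] when it leaves it.  A path of the
    original rows of at least that weight gives a term of the right side. *)
Lemma passage2_le a b f c : periodic a -> periodic b ->
  (forall k, f (k + n)%N = f k + c) ->
  forall i, passage (lowz a b) (passage (upz a b) f) i <= passage a (passage b f) i.
Proof.
move=> pa pb pf i; set a' := lowz a b; set b' := upz a b.
have pa' : periodic a' by apply: lowz_periodic.
have pb' : periodic b' by apply: upz_periodic.
have hab k : height a' k + height b' k = height a k + height b k.
  by rewrite /a' /b' height_low // height_up //; lia.
have [k hk ->] := passage_ex a' (passage b' f) i.
have [l hl ->] := passage_ex b' f k.+1.
have ub k' l' : (i <= k' < i + n)%N -> (k' < l' <= k' + n)%N ->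
    height a i + (height b k'.+1 + (f l'.+1 - height b l') - height a k')
      <= passage a (passage b f) i.
  move=> hk' hl'; have := passage_ge a (passage b f) hk'.
  have /(passage_ge b f) : (k'.+1 <= l' < k'.+1 + n)%N by lia.
  lia.
(* The path of the exchanged rows starts at i if the window is not left, and
   one period before l otherwise. *)
have [ltl|lel] := ltnP l (i + n).
  have hil : (i <= k < l)%N by lia.
  have [k' hk'] := path_weight_low_le pa pb hil.
  have := ub k' l; rewrite /path_weight -/a' -/b'.
  have := hab i; have := hab l; lia.
have hil : (l - n <= k < i + n)%N by lia.
have [k' hk'] := path_weight_low_le pa pb hil.
have := ub k' l; rewrite /path_weight -/a' -/b'.
have El : l = (l - n + n)%N by lia.
have := height_periodic n_gt0 pb (l - n); have := height_periodic n_gt0 pb' (l - n).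
rewrite -El.
have := height_periodic n_gt0 pa i; have := height_periodic n_gt0 pa' i.
have := hab n; lia.
Qed.

(** By [lowzK] the inequality for the exchanged rows is the converse of the one
    for the original rows. *)
Lemma passage2_low a b f c : periodic a -> periodic b ->
  (forall k, f (k + n)%N = f k + c) ->
  passage (lowz a b) (passage (upz a b) f) =1 passage a (passage b f).
Proof.
move=> pa pb pf i; apply: le_anti; rewrite (passage2_le pa pb pf) /=.
have pa' : periodic (lowz a b) by apply: lowz_periodic.
have pb' : periodic (upz a b) by apply: upz_periodic.
have := passage2_le pa' pb' pf i; rewrite (eq_passage _ (lowzK pa pb) (fun=> erefl)).
by rewrite (eq_passage _ (fun=> erefl) (fun k => eq_passage k (upzK pa pb) (fun=> erefl))).
Qed.

(** Both sides are the increments of the same composite of two passage operators,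
    applied to the height of [c]. *)
Lemma lowz_yb a b c : periodic a -> periodic b -> periodic c ->
  lowz (lowz a b) (lowz (upz a b) c) =1 lowz a (lowz b c).
Proof.
move=> pa pb pc t.
have pf k : height c (k + n) = height c k + height c n by apply: height_periodic.
have E a1 b1 : lowz a1 (lowz b1 c) t =
    passage a1 (passage b1 (height c)) t.+1 - passage a1 (passage b1 (height c)) t.
  rewrite lowz_passage.
  rewrite !(eq_passage (f := height (lowz b1 c)) _ (fun=> erefl) (height_lowz_passage b1 c)).
  by rewrite !passage_subc; lia.
by rewrite !E !(passage2_low pa pb pf).
Qed.

(** Compare maximizers of the crest for [c] at [t] and for [b] at [t + 1].
    Whatever their order, they can be redistributed between the two other
    windows, since the difference of the heights of [c] and [b] increases. *)
Lemma lowz_mono a b c : (forall t, b t <= c t) -> forall t, lowz a b t <= lowz a c t.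
Proof.
move=> bc t.
pose g k := height c k - height b k.
have gS k : g k <= g k.+1 by rewrite /g !heightS; have := bc k; lia.
have gm k d : g k <= g (k + d)%N.
  by elim: d => [|d IH]; rewrite ?addn0 // addnS; have := gS (k + d)%N; lia.
have [k' hk' e'] := wmax_ex n_gt0 (profile a c) t.
have [k hk e] := wmax_ex n_gt0 (profile a b) t.+1.
rewrite /lowz /crest e e'.
have [le|lt] := leqP k' k.
  have h1 := @wmax_ge _ n_gt0 (profile a b) t k'; have h2 := @wmax_ge _ n_gt0 (profile a c) t.+1 k.
  have := gm k'.+1 (k - k')%N; rewrite (_ : k'.+1 + (k - k') = k.+1)%N; last by lia.
  by move: h1 h2; rewrite /profile /g; lia.
have h1 := @wmax_ge _ n_gt0 (profile a b) t k; have h2 := @wmax_ge _ n_gt0 (profile a c) t.+1 k'.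
by lia.
Qed.

End YangBaxter.

(** * Cyclic bracket matching *)

Section Stuck.
Variable T : Type.
Implicit Types w : seq (bool * T).

Lemma match_stepP w :
  (exists x y t p, [/\ rot p w = (true, x) :: (false, y) :: t & match_step w = t]) \/
  match_step w = w /\ forall p, (p < size w)%N -> ~~ head_match (rot p w).
Proof.
rewrite /match_step; set P := fun p => head_match (rot p w).
case: ifP => hp; [left|right].
  have hs : has P (iota 0 (size w)) by rewrite has_find size_iota.
  have := nth_find 0 hs; rewrite nth_iota // add0n; set p := find _ _ => hP.
  case E : (rot p w) hP => [|[[] x] [|[[] y] t]] //; rewrite /P E // => _.
  by exists x, y, t, p; rewrite E /= drop0.
split=> // p lp; apply/negP => hP; move: hp.
have -> // : (find P (iota 0 (size w)) < size w)%N.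
rewrite -[X in (_ < X)%N](size_iota 0) -has_find; apply/hasP.
by exists p => //; rewrite mem_iota.
Qed.

Lemma size_match_step w : match_step w = w \/ (size (match_step w) + 2 = size w)%N.
Proof.
case: (match_stepP w) => [[x [y [t [p [e ->]]]]]|[]]; [right|by left].
by rewrite -(size_rot p w) e /= addn2.
Qed.

(** Each effective step shortens the word, so as many steps as there are
    letters reach a fixed point. *)
Lemma unmatched_stuck w p : (p < size (unmatched w))%N -> ~~ head_match (rot p (unmatched w)).
Proof.
have fix_um : match_step (unmatched w) = unmatched w.
  rewrite /unmatched; move: {2 3 4}(size w) (leqnn (size w)) => m.
  elim: m w => [|m IH] w; first by rewrite leqn0 => /nilP ->.
  case: (size_match_step w) => [e _|e h]; first by rewrite (iter_fix _ e).
  by rewrite iterSr IH //; lia.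
case: (match_stepP (unmatched w)) => [[x [y [t [q [e et]]]]]|[_]]; last exact.
by have := congr1 size e; rewrite size_rot /= -{1}fix_um et; lia.
Qed.

Lemma first_has (P : pred (bool * T)) w : has P w ->
  exists s1 x s2, [/\ w = s1 ++ x :: s2, P x & ~~ has P s1].
Proof.
elim: w => [//|x w IH] /=; have [Px _|nPx hw] := boolP (P x).
  by exists [::], x, w.
have [s1 [y [s2 [-> Py h]]]] := IH hw.
by exists (x :: s1), y, s2; rewrite /= negb_or nPx.
Qed.

(** Going around the circle from an opening bracket to the first closing one
    would reveal a matching pair. *)
Lemma stuck_unicolor w : (forall p, (p < size w)%N -> ~~ head_match (rot p w)) ->
  all (fun b => b.1) w \/ all (fun b => ~~ b.1) w.
Proof.
move=> stuck.
case E : (all (fun b => ~~ b.1) w); [by right|left].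
move/negbT: E; rewrite -has_predC => hs.
apply/negbNE/negP; rewrite -has_predC => hf.
have [u [[c x] [v [e /= /negPn cT _]]]] := first_has hs; rewrite {}cT {c} in e.
have er : rot (size u) w = (true, x) :: v ++ u by rewrite e rot_size_cat.
have : has (predC (fun b => b.1)) (v ++ u) by move: hf; rewrite -(has_rot (size u)) er.
move=> /first_has[s1 [[c y] [s2 [e2 /= /negPf cF h1]]]]; rewrite {}cF {c} in e2.
have [s0 [z ez]] : exists s0 z, (true, x) :: s1 = rcons s0 z.
  by exists (belast (true, x) s1), (last (true, x) s1); rewrite lastI.
have zT : z.1.
  have : all (fun b => b.1) (rcons s0 z).
    by rewrite -ez /=; move: h1; rewrite has_predC negbK.
  by rewrite all_rcons => /andP[].
have e3 : rot (size u) w = s0 ++ z :: (false, y) :: s2.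
  by rewrite er e2 -cat_cons ez cat_rcons.
have hm : head_match (rot (size s0) (rot (size u) w)).
  by rewrite e3 rot_size_cat; case: (z) zT => [[] z'].
have lu : (size u < size w)%N by rewrite e size_cat /=; lia.
have ls : (size s0 < size w)%N by have := congr1 size e3; rewrite size_rot size_cat /=; lia.
move: hm; rewrite rot_add_mod; [|by lia|by lia].
case: leqP => hsz; last by apply/negP; apply: stuck; lia.
have [e4|ne] := eqVneq (size s0 + size u)%N (size w); last by apply/negP; apply: stuck; lia.
rewrite e4 rot_size -[w in head_match w](rot0).
by apply/negP; apply: stuck; lia.
Qed.

Lemma iter_match_step_ind (P : seq (bool * T) -> Prop) w :
  (forall w, P w -> P (match_step w)) -> P w -> P (unmatched w).
Proof. by move=> h Pw; rewrite /unmatched; elim: (size w) => //= m; apply: h. Qed.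

End Stuck.

Section Words.
Variable n' : nat.
Local Notation n := n'.+1.
Notation crest := (crest n).
Implicit Types w : seq (bool * 'I_n).

Definition wcount w (c : bool) (t : nat) : int := (count_mem (c, inord (t %% n)) w)%:Z.

(** By [excess_unmatched], the number of unmatched closing brackets at a site
    minus that of unmatched opening brackets. *)
Definition excess w (t : nat) : int :=
  crest (wcount w true) (wcount w false) t.+1 - crest (wcount w true) (wcount w false) t.

(** Lexicographic order: by site, and closing before opening within a site. *)
Definition bracket_le (x y : bool * 'I_n) := (x.2.*2 + x.1 <= y.2.*2 + y.1)%N.

Definition cyc_sorted w := exists2 k, (k <= size w)%N & pairwise bracket_le (rot k w).

Lemma wcount_periodic w c : periodic n (wcount w c).
Proof. by move=> t; rewrite /wcount modnDr. Qed.

Lemma perm_wcount w w' c t : perm_eq w w' -> wcount w c t = wcount w' c t.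
Proof. by move=> /permP e; rewrite /wcount e. Qed.

Lemma cyc_sorted_rot p w : cyc_sorted w -> cyc_sorted (rot p w).
Proof.
move=> [k hk sk].
have [lp|lp] := leqP p (size w); last by rewrite rot_oversize 1?ltnW //; exists k.
rewrite -(rotK p w) {1}/rotr rot_add_mod ?size_rot ?leq_subr // in sk.
by eexists; last exact: sk; rewrite size_rot; case: ifP; lia.
Qed.

(** If an opening bracket at [i] is followed by a closing one at [j] in a
    cyclically sorted word, no other bracket lies on the arc of the circle from
    [i] to [j].  The two cases say whether the arc passes through site 0;
    [j = i] is a full turn. *)
Lemma cyc_sorted_cons2 (i j : 'I_n) t : cyc_sorted ((true, i) :: (false, j) :: t) ->
  cyc_sorted t /\
  ((i < j)%N /\ (forall z, z \in t -> (z.2 <= i)%N || (j <= z.2)%N) \/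
   (j <= i)%N /\ (forall z, z \in t -> (j <= z.2 <= i)%N)).
Proof.
move=> [[|[|k]] hk].
- rewrite rot0 /= => /and3P[/andP[hij _] hj st]; split; first by exists 0%N; rewrite ?rot0.
  left; rewrite /bracket_le /= in hij; split; first by lia.
  by move=> z zt; move/allP: hj => /(_ z zt); rewrite /bracket_le /=; lia.
- rewrite rot1_cons -cats1 /= cats1 all_rcons pairwise_rcons => /and3P[/andP[hji hj] hi st].
  split; first by exists 0%N; rewrite ?rot0.
  right; rewrite /bracket_le /= in hji; split; first by lia.
  move=> z zt; move/allP: hj => /(_ z zt); move/allP: hi => /(_ z zt).
  by rewrite /bracket_le /=; case: (z.1); lia.
rewrite /rot /= pairwise_cat /= => /and5P[/allrelP hxy st /andP[hij hx] hy st'].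
split.
  exists k; first by rewrite /= in hk; lia.
  rewrite /rot pairwise_cat st st' !andbT; apply/allrelP => x y xt yt.
  by apply: hxy => //; rewrite !inE yt !orbT.
left; rewrite /bracket_le /= in hij; split; first by lia.
move=> z; rewrite -[t in z \in t](cat_take_drop k) mem_cat => /orP[] zt.
  by move/allP: hy => /(_ z zt); rewrite /bracket_le /=; lia.
have := hxy z (true, i) zt; rewrite !inE eqxx /bracket_le /= => /(_ isT).
by case: (z.1); lia.
Qed.

End Words.

(** * Erasing a matched pair leaves the crest increments unchanged *)

Section Erase.
Variable n : nat.
Hypothesis n_gt0 : (0 < n)%N.

Definition site_ind (i t : nat) : int := ((t %% n)%N == i)%:Z.

Lemma height_site_ind i q r : (i < n)%N -> (r <= n)%N ->
  height (site_ind i) (q * n + r) = q%:Z + (i < r)%N%:Z.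
Proof.
move=> lin; elim: q r => [|q IHq]; elim=> [|r IHr] lrn.
- by rewrite height0.
- rewrite addnS heightS IHr ?(ltnW lrn) // /site_ind modnMDl modn_small //.
  by lia.
- by rewrite addn0 mulSn addnC IHq // lin; lia.
- rewrite addnS heightS IHr ?(ltnW lrn) // /site_ind modnMDl modn_small //.
  by lia.
Qed.

(** A dip of depth one does not change a window maximum if every window that
    meets the dip contains a point outside of it with at least the same value. *)
Lemma wmax_valley f g (v : pred nat) c s :
  (forall k, g k = f k + c - (v k)%:Z) ->
  (forall k, (s <= k < s + n)%N -> v k ->
     exists k', [/\ (s <= k' < s + n)%N, ~~ v k' & f k <= f k']) ->
  wmax n g s = wmax n f s + c.
Proof.
move=> gE hv.
have h1 : wmax n g s <= wmax n f s + c.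
  by apply: wmax_le => // k /(wmax_ge n_gt0 f); have := gE k; lia.
have [k hk ek] := wmax_ex n_gt0 f s.
have [k' [hk' /negPf nv le]] : exists k', [/\ (s <= k' < s + n)%N, ~~ v k' & f k <= f k'].
  by case vk : (v k); [apply: hv|exists k; rewrite vk].
have := wmax_ge n_gt0 g hk'; rewrite gE nv; lia.
Qed.

Variables (i j : nat) (a b : nat -> int).
Hypotheses (lin : (i < n)%N) (ljn : (j < n)%N).
Hypotheses (a_ge0 : forall s, 0 <= a s) (b_ge0 : forall s, 0 <= b s).

Let V r := if (i < j)%N then (i < r < j)%N else (r < j)%N || (i < r)%N.

Hypothesis ab0 : forall s, V (s %% n) -> a s = 0 /\ b s = 0.

(** Adding a matched pair shifts the profile by a constant, except on the arc
    [V] of sites strictly between the two brackets. *)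
Lemma profile_valley k :
  profile (fun s => a s + site_ind i s) (fun s => b s + site_ind j s) k =
  profile a b k + (~~ (i < j)%N)%:Z - (V (k %% n))%:Z.
Proof.
rewrite /profile !(@height_add _ _ (fun s => _ + _) _ (fun=> erefl)).
have lr : (k %% n < n)%N by rewrite ltn_mod.
have e1 := @height_site_ind i (k %/ n) (k %% n) lin (ltnW lr).
have e2 := @height_site_ind j (k %/ n) (k %% n).+1 ljn lr.
rewrite addnS -divn_eq in e2; rewrite -divn_eq in e1; rewrite e1 e2 /V.
by case: ifP => h; lia.
Qed.

(** An arc strictly between [i] and [j] spans fewer than [n] sites, hence a window
    of length [n] that meets it contains one of its two ends. *)
Lemma valley_ends k : (n <= k)%N -> V (k %% n) ->
  exists x y, [/\ (x < k < y)%N, (y <= x + n)%N, ~~ V (x %% n), ~~ V (y %% n) &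
    forall s, (x < s < y)%N -> V (s %% n)].
Proof.
move=> lnk; have lr : (k %% n < n)%N by rewrite ltn_mod.
have ek := divn_eq k n; set q := (k %/ n)%N in ek; set r := (k %% n)%N in ek lr *.
have mod_q (q1 r1 : nat) : (r1 < n)%N -> ((q1 * n + r1) %% n)%N = r1.
  by move=> h; rewrite modnMDl modn_small.
rewrite /V; case: (ltnP i j) => lij hr.
  exists (q * n + i)%N, (q * n + j)%N; rewrite !mod_q //.
  split; [lia|lia|lia|lia|] => s hs.
  have -> : s = (q * n + (s - q * n))%N by lia.
  by rewrite mod_q; lia.
have wrap q' s : (q' * n + i < s < q'.+1 * n + j)%N -> (s %% n < j)%N || (i < s %% n)%N.
  rewrite mulSn => hs; have [lt|le] := ltnP s (n + q' * n).
    have -> : s = (q' * n + (s - q' * n))%N by lia.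
    by rewrite mod_q; lia.
  have -> : s = (q'.+1 * n + (s - q'.+1 * n))%N by rewrite mulSn; lia.
  by rewrite mod_q mulSn; lia.
case: (ltnP i r) => hir.
  exists (q * n + i)%N, (q.+1 * n + j)%N; rewrite !mod_q //.
  by split; [rewrite mulSn; lia|rewrite mulSn; lia|lia|lia|exact: wrap].
case: q ek => [|q] ek; first by move: lnk; rewrite ek; lia.
exists (q * n + i)%N, (q.+1 * n + j)%N; rewrite !mod_q //.
by split; [move: ek; rewrite mulSn; lia|rewrite mulSn; lia|lia|lia|exact: wrap].
Qed.

Lemma crest_erase s : (n <= s)%N ->
  crest n (fun s => a s + site_ind i s) (fun s => b s + site_ind j s) s =
    crest n a b s + (~~ (i < j)%N)%:Z.
Proof.
move=> lns; apply: wmax_valley profile_valley _ => k hk Vk.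
have [|x [y [hxy lyx nVx nVy hV]]] := valley_ends _ Vk; first by lia.
have [hx hy] := profile_flat a_ge0 b_ge0 (fun s hs => ab0 (hV s hs)) hxy.
have [lt|le] := ltnP y (s + n); first by exists y; split=> //; lia.
by exists x; split=> //; lia.
Qed.

End Erase.

Section Excess.
Variable n' : nat.
Local Notation n := n'.+1.
Notation crest := (crest n).
Implicit Types (w : seq (bool * 'I_n)) (i j : 'I_n).

Lemma wcount_cons w c c' i t :
  wcount ((c', i) :: w) c t = wcount w c t + (if c == c' then site_ind n i t else 0).
Proof.
rewrite /wcount /= xpair_eqE /site_ind -val_eqE /= inordK ?ltn_mod //.
by rewrite (eq_sym (t %% n)%N) (eq_sym c); case: (c' == c); rewrite ?PoszD ?add0n; lia.
Qed.

Lemma excess_periodic w t : excess w (t + n) = excess w t.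
Proof.
have per := @crest_periodic n isT _ _ (wcount_periodic w true) (wcount_periodic w false).
by rewrite /excess -addSn !per; lia.
Qed.

(** The erased pair spans an arc without other brackets, over which the profile of
    the remaining word is flat and not above its ends; so the two crests differ
    by a constant. *)
Lemma excess_cons2 i j w : cyc_sorted ((true, i) :: (false, j) :: w) ->
  excess ((true, i) :: (false, j) :: w) =1 excess w.
Proof.
move=> /cyc_sorted_cons2[_ hw] t.
(* One period later, the arc around any site has both ends at nonnegative sites. *)
rewrite -excess_periodic -[RHS]excess_periodic /excess.
have z0 c s (k : 'I_n) : (s %% n)%N = k -> (c, k) \notin w -> wcount w c s = 0.
  by move=> es /count_memPn h; rewrite /wcount es inord_val h.
have E s : (n <= s)%N ->
    crest (wcount ((true, i) :: (false, j) :: w) true)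
      (wcount ((true, i) :: (false, j) :: w) false) s =
    crest (wcount w true) (wcount w false) s + (~~ (i < j)%N)%:Z.
  move=> ls; rewrite -(@crest_erase n isT i j) //; last first.
    move=> r; case: (hw) => -[lij h].
      rewrite lij => hr.
      have ev : (r %% n)%N = Ordinal (ltn_pmod r (ltn0Sn n')) by [].
      by split; apply: z0 ev _; apply/negP => /h /=; lia.
    rewrite ltnNge lij /= => hr.
    have ev : (r %% n)%N = Ordinal (ltn_pmod r (ltn0Sn n')) by [].
    by split; apply: z0 ev _; apply/negP => /h /=; lia.
  by apply: eq_crest => // r; rewrite !wcount_cons /= ?addr0.
by rewrite !E; lia.
Qed.

Lemma eq_excess w w' : (forall c, wcount w c =1 wcount w' c) -> excess w =1 excess w'.
Proof. by move=> e t; rewrite /excess !(eq_crest _ _ (e true) (e false)). Qed.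

Lemma match_step_invariant w : cyc_sorted w ->
  cyc_sorted (match_step w) /\ excess (match_step w) =1 excess w.
Proof.
move=> sw; case: (match_stepP w) => [[i [j [t [p [er ->]]]]]|[-> _]] //.
have pw : perm_eq (rot p w) w by rewrite perm_rot.
have := cyc_sorted_rot p sw; rewrite er => sr; split.
  by case: (cyc_sorted_cons2 sr).
move=> s; rewrite -(excess_cons2 sr) -er.
by apply: eq_excess => c r; apply: perm_wcount.
Qed.

(** The excess does not change during the matching, and the final word has brackets
    of one kind only: its profile is monotone, so each window maximum is taken at
    an end of the window. *)
Lemma excess_unmatched w : cyc_sorted w -> forall t,
  excess w t = wcount (unmatched w) false t - wcount (unmatched w) true t.
Proof.
move=> sw s; set u := unmatched w.
have [_ e] : cyc_sorted u /\ excess u =1 excess w.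
  apply: (iter_match_step_ind (P := fun v => cyc_sorted v /\ excess v =1 excess w)) => // v [sv ev].
  have [sv' ev'] := match_step_invariant sv.
  by split=> // t; rewrite ev'.
rewrite -{}e; case: (stuck_unicolor (@unmatched_stuck _ w)); rewrite -/u => hu.
  have z t : wcount u false t = 0.
    rewrite /wcount; suff /count_memPn -> : (false, inord (t %% n)) \notin u by [].
    by apply/negP => /(allP hu).
  have crestE t : crest (wcount u true) (wcount u false) t = - height (wcount u true) t.
    have profileE k : profile (wcount u true) (wcount u false) k = - height (wcount u true) k.
      by rewrite /profile (@height_const _ 0 k.+1) ?height0 // => *; lia.
    apply: le_anti; rewrite -profileE wmax_ge ?andbT //; last by lia.
    apply: wmax_le => // k hk; rewrite !profileE.
    by rewrite lerN2; apply: height_mono => //; lia.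
  by rewrite /excess !crestE z heightS; lia.
have z t : wcount u true t = 0.
  rewrite /wcount; suff /count_memPn -> : (true, inord (t %% n)) \notin u by [].
  by apply/negP => /(allP hu).
have crestE t : crest (wcount u true) (wcount u false) t = height (wcount u false) (t + n).
  have profileE k : profile (wcount u true) (wcount u false) k = height (wcount u false) k.+1.
    by rewrite /profile (@height_const (wcount u true) 0 k) ?height0 ?subr0.
  apply: le_anti; rewrite addnS -profileE wmax_ge ?andbT //; last by lia.
  apply: wmax_le => // k hk; rewrite !profileE.
  by apply: height_mono => //; lia.
by rewrite /excess !crestE z addSn heightS wcount_periodic; lia.
Qed.

Lemma count_unmatched w x : (count_mem x (unmatched w) <= count_mem x w)%N.
Proof.
apply: (iter_match_step_ind (P := fun v => count_mem x v <= count_mem x w)%N) => // v.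
apply: leq_trans; case: (match_stepP v) => [[i [j [t [p [er ->]]]]]|[-> _]] //.
have pw : perm_eq (rot p v) v by rewrite perm_rot.
by rewrite -(permP pw) er /=; lia.
Qed.

End Excess.

(** * The exchange of two rows of particles *)

Local Open Scope mset_scope.

Section Msets.
Variable n' : nat.
Local Notation n := n'.+1.
Implicit Types (A B C : {mset 'I_n}) (i j : 'I_n).

Definition mcount A (t : nat) : int := (A (inord (t %% n)))%:Z.

Lemma mcount_ord A i : mcount A i = (A i)%:Z.
Proof. by rewrite /mcount modn_small // inord_val. Qed.

Lemma mcount_inj A B : mcount A =1 mcount B -> A = B.
Proof. by move=> e; apply/msetP => i; have := e i; rewrite !mcount_ord; lia. Qed.

Lemma mcount_periodic A : periodic n (mcount A).
Proof. by move=> t; rewrite /mcount modnDr. Qed.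

Lemma size_mset_sum A : size A = (\sum_i A i)%N.
Proof.
under eq_bigr => i _ do rewrite -count_mem_mset.
elim: (enum_mset A) => [|x s IH] /=; first by rewrite big1.
by rewrite big_split /= -IH (bigD1 x) //= eqxx big1 // => i /negPf; rewrite eq_sym => ->.
Qed.

Lemma height_mcount A : height (mcount A) n = (size A)%:Z.
Proof.
rewrite size_mset_sum (big_morph Posz PoszD (erefl _)) /height.
by apply: eq_bigr => i _; rewrite mcount_ord.
Qed.

Lemma count_cpair A B c i : count_mem (c, i) (cpair_b A B) = (if c then A i else B i).
Proof.
rewrite /cpair_b count_flatten -map_comp sumnE big_map big_enum /= (bigD1 i) //= big1.
  rewrite count_cat !count_nseq /= !xpair_eqE !eqxx /=.
  by case: c; rewrite /= ?mul0n ?mul1n ?add0n ?addn0.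
by move=> j /negPf nji; rewrite count_cat !count_nseq /= !xpair_eqE nji !andbF !mul0n.
Qed.

Lemma cyc_sorted_cpair A B : cyc_sorted (cpair_b A B).
Proof.
exists 0%N => //; rewrite rot0 /cpair_b.
have : pairwise (relpre val ltn) (enum 'I_n).
  by rewrite -pairwise_map val_enum_ord -sorted_pairwise ?iota_ltn_sorted //; apply: ltn_trans.
elim: (enum 'I_n) => //= j s IH /andP[js /IH {}IH].
rewrite pairwise_cat IH andbT; apply/andP; split.
  apply/allrelP => x y; rewrite mem_cat => hx /flattenP[_ /mapP[k ks ->]].
  move/allP: js => /(_ k ks) /=; rewrite mem_cat => jk hy.
  have -> : y = (y.1, k) by case/orP: hy => /nseqP[->].
  have -> : x = (x.1, j) by case/orP: hx => /nseqP[->].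
  by rewrite /bracket_le /=; case: (x.1); case: (y.1); lia.
rewrite pairwise_cat; apply/and3P; split.
- by apply/allrelP => x y /nseqP[-> _] /nseqP[-> _]; rewrite /bracket_le /=; lia.
- by elim: (B j) => //= m ->; rewrite andbT all_nseq /bracket_le leqnn orbT.
- by elim: (A j) => //= m ->; rewrite andbT all_nseq /bracket_le leqnn orbT.
Qed.

Lemma unpaired_lowerE A B i : unpaired_lower A B i = count_mem (true, i) (unmatched (cpair_b A B)).
Proof.
rewrite /unpaired_lower mset_seqE count_map count_filter; apply: eq_count => -[c j] /=.
by rewrite xpair_eqE andbC; case: c.
Qed.

Lemma unpaired_upperE A B i : unpaired_upper A B i = count_mem (false, i) (unmatched (cpair_b A B)).
Proof.
rewrite /unpaired_upper mset_seqE count_map count_filter; apply: eq_count => -[c j] /=.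
by rewrite xpair_eqE andbC; case: c.
Qed.

Lemma unpaired_lower_le A B i : (unpaired_lower A B i <= A i)%N.
Proof. by rewrite unpaired_lowerE -(count_cpair A B true) count_unmatched. Qed.

Lemma unpaired_upper_le A B i : (unpaired_upper A B i <= B i)%N.
Proof. by rewrite unpaired_upperE -(count_cpair A B false) count_unmatched. Qed.

Lemma unpaired_lower0_or A B :
  (forall i, unpaired_lower A B i = 0%N) \/ (forall i, unpaired_upper A B i = 0%N).
Proof.
case: (stuck_unicolor (@unmatched_stuck _ (cpair_b A B))) => /allP hu; [right|left] => i.
  by rewrite unpaired_upperE; apply/count_memPn/negP => /hu.
by rewrite unpaired_lowerE; apply/count_memPn/negP => /hu.
Qed.

(** The lower row of the exchange of [A] (below) and [B] (above), that is of
    sigma restricted to these two rows. *)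
Definition low A B := (A `\` unpaired_lower A B) `+` unpaired_upper A B.
Definition up A B := (B `\` unpaired_upper A B) `+` unpaired_lower A B.

(** By [excess_unmatched], the crest increment at a site is the number of unpaired
    upper particles minus that of unpaired lower ones. *)
Lemma mcount_low A B : mcount (low A B) =1 lowz n (mcount A) (mcount B).
Proof.
move=> t; pose w := cpair_b A B.
have wE c : wcount w c =1 mcount (if c then A else B).
  by move=> s; rewrite /wcount count_cpair; case: c.
have : lowz n (mcount A) (mcount B) t = mcount A t + excess w t.
  by rewrite /lowz /excess !(eq_crest _ _ (wE true) (wE false)) /=; lia.
rewrite /w (excess_unmatched (cyc_sorted_cpair A B)) => ->.
rewrite /mcount /low !msetE2 /wcount -unpaired_lowerE -unpaired_upperE.
by have := unpaired_lower_le A B (inord (t %% n)); lia.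
Qed.

Lemma low_up_add A B i : (low A B i + up A B i = A i + B i)%N.
Proof.
rewrite /low /up !msetE2.
by have := unpaired_lower_le A B i; have := unpaired_upper_le A B i; lia.
Qed.

Lemma mcount_up A B : mcount (up A B) =1 upz n (mcount A) (mcount B).
Proof.
move=> t; rewrite /upz -mcount_low /mcount.
by have := low_up_add A B (inord (t %% n)); lia.
Qed.

Lemma size_low A B : size (low A B) = size B.
Proof.
suff : (size (low A B))%:Z = (size B)%:Z by lia.
rewrite -!height_mcount (eq_height _ (mcount_low A B)) height_low //.
have := crest_periodic (isT : (0 < n)%N) (@mcount_periodic A) (@mcount_periodic B) 0.
by rewrite add0n; lia.
Qed.

Lemma size_up A B : size (up A B) = size A.
Proof.
have : (size (low A B) + size (up A B) = size A + size B)%N.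
  rewrite !size_mset_sum -!big_split /=; apply: eq_bigr => i _; exact: low_up_add.
by rewrite size_low; lia.
Qed.

Lemma lowK A B : low (low A B) (up A B) = A.
Proof.
apply: mcount_inj => t; rewrite mcount_low.
rewrite (eq_lowz _ (mcount_low A B) (mcount_up A B)) // lowzK //; exact: mcount_periodic.
Qed.

(** The bottom row of the Yang-Baxter equation for three rows [A], [B], [C]. *)
Lemma low_yb A B C : low (low A B) (low (up A B) C) = low A (low B C).
Proof.
apply: mcount_inj => t; rewrite mcount_low.
have e1 s : mcount (low (up A B) C) s = lowz n (upz n (mcount A) (mcount B)) (mcount C) s.
  by rewrite mcount_low; apply: eq_lowz => // r; rewrite mcount_up.
rewrite (eq_lowz _ (mcount_low A B) e1) // lowz_yb //; try exact: mcount_periodic.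
by rewrite mcount_low; apply: eq_lowz => // r; rewrite mcount_low.
Qed.

Lemma low_mono A B C : (forall i, B i <= C i)%N -> forall i, (low A B i <= low A C i)%N.
Proof.
move=> BC i; rewrite -lez_nat -!mcount_ord !mcount_low.
by apply: lowz_mono => // t; rewrite lez_nat.
Qed.

Lemma size_unpaired A B :
  (size A + size (unpaired_upper A B) = size B + size (unpaired_lower A B))%N.
Proof.
rewrite -(size_low A B) !size_mset_sum -!big_split /=; apply: eq_bigr => i _.
by rewrite /low !msetE2 addnAC subnK ?unpaired_lower_le.
Qed.

Lemma size_eq0 A : size A = 0%N -> forall i, A i = 0%N.
Proof. by move=> s0 i; rewrite -count_mem_mset (size0nil s0). Qed.

Lemma unpaired_lower0 A B i : (size A <= size B)%N -> unpaired_lower A B i = 0%N.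
Proof.
have := size_unpaired A B; case: (unpaired_lower0_or A B) => [->//|h].
rewrite [size (unpaired_upper A B)]size_mset_sum big1 // => e le.
by apply: size_eq0; lia.
Qed.

Lemma unpaired_upper0 A B i : (size B <= size A)%N -> unpaired_upper A B i = 0%N.
Proof.
have := size_unpaired A B; case: (unpaired_lower0_or A B) => [h|->//].
rewrite [size (unpaired_lower A B)]size_mset_sum big1 // => e le.
by apply: size_eq0; lia.
Qed.

End Msets.

(** * Inserting a row into a decreasing sequence of rows *)

Local Open Scope nat_scope.

Section Insertion.
Variable n' : nat.
Local Notation n := n'.+1.
Implicit Types (A B C D : {mset 'I_n}) (U V : nat -> {mset 'I_n}) (i j : 'I_n).

Lemma low_same A B : size A = size B -> low A B = A.
Proof.
move=> e; apply/msetP => i.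
by rewrite /low !msetE2 unpaired_lower0 ?unpaired_upper0 ?e // subn0 addn0.
Qed.

Lemma up_same A B : size A = size B -> up A B = B.
Proof.
move=> e; apply/msetP => i.
by rewrite /up !msetE2 unpaired_lower0 ?unpaired_upper0 ?e // subn0 addn0.
Qed.

Lemma upK A B : up (low A B) (up A B) = B.
Proof.
apply/msetP => i; have := low_up_add (low A B) (up A B) i.
by rewrite lowK low_up_add => /addnI.
Qed.

(** [U] stands for a sequence of rows of decreasing sizes.  Each
    of them is replaced by its exchange with [D], and [D] enters just before the
    first row that is smaller. *)
Fixpoint insert D U k : {mset 'I_n} :=
  match k with
  | 0 => if size D <= size (U 0) then low D (U 0) else D
  | k'.+1 => if size D <= size (U 0) then insert D (fun m => U m.+1) k' else low D (U k')
  end.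

Lemma eq_insert D U V : U =1 V -> insert D U =1 insert D V.
Proof.
move=> UV k; elim: k U V UV => [|k IH] U V UV /=; rewrite !UV //.
by rewrite (IH _ (fun m => V m.+1)).
Qed.

(** By [low_yb] the exchange with [low A B] after [up A B] is that with [A] after
    [B]; the inserted row [low A B] has the size of [B], hence lands in the same
    place. *)
Lemma insert_low A B U k :
  insert (low A B) (fun m => low (up A B) (U m)) k = low A (insert B U k).
Proof.
elim: k U => [|k IH] U /=; rewrite !size_low; case: ifP => // _; rewrite ?low_yb //.
Qed.

Lemma insert_low_rev A B U k :
  insert A (fun m => low B (U m)) k = low (low A B) (insert (up A B) U k).
Proof. by rewrite -insert_low lowK upK. Qed.

(** After the exchange, [low A B] has the size of [B] and [up A B] the size of
    [A], so the two insertions fill the same places in the other order.  The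
    rows of [U] agree by [low_yb], the two inserted ones by [lowK], and rows of
    equal size are not moved at all. *)
Lemma insert_exchange A B U : insert A (insert B U) =1 insert (low A B) (insert (up A B) U).
Proof.
move=> k; elim: k U => [|k IH] U /=; rewrite size_low size_up.
  case: (leqP (size B) (size (U 0))) => hB; case: (leqP (size A) (size (U 0))) => hA.
  - by rewrite !size_low hA hB low_yb.
  - by rewrite size_low size_up leqNgt hA /= (leq_trans hB (ltnW hA)) lowK.
  - by rewrite size_low (leqNgt (size B)) hB /= (leq_trans hA (ltnW hB)).
  - by rewrite size_up; case: ltngtP => // e; rewrite lowK // low_same.
case: (leqP (size B) (size (U 0))) => hB; case: (leqP (size A) (size (U 0))) => hA.
- by rewrite !size_low hA hB (IH (fun m => U m.+1)).
- by rewrite size_low size_up leqNgt hA /= (leq_trans hB (ltnW hA)) insert_low.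
- by rewrite size_low (leqNgt (size B)) hB /= (leq_trans hA (ltnW hB)) insert_low_rev.
rewrite size_up; case: ltngtP => // e.
- by rewrite insert_low_rev.
- by rewrite insert_low.
- by rewrite low_same // up_same.
Qed.

Lemma paired_lowerE A B i : paired_lower A B i = A i - unpaired_lower A B i.
Proof. by rewrite /paired_lower msetE2. Qed.

Lemma lowE A B i : low A B i = paired_lower A B i + unpaired_upper A B i.
Proof. by rewrite /low msetE2. Qed.

Lemma low_ge A B : size A <= size B -> low A B = A `+` unpaired_upper A B.
Proof. by move=> h; apply/msetP => i; rewrite lowE paired_lowerE unpaired_lower0 // subn0 msetE2. Qed.

Lemma low_le A B : size B <= size A -> low A B = paired_lower A B.
Proof. by move=> h; apply/msetP => i; rewrite lowE unpaired_upper0 // addn0. Qed.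

Lemma paired_lower_ge A B : size A <= size B -> paired_lower A B = A.
Proof. by move=> h; apply/msetP => i; rewrite paired_lowerE unpaired_lower0 // subn0. Qed.

Lemma unpaired_upper_le0 A B : size B <= size A -> unpaired_upper A B = mset0.
Proof. by move=> h; apply/msetP => i; rewrite unpaired_upper0 // mset0E. Qed.

Lemma leq_size_msubset B C : (forall i, B i <= C i) -> size B <= size C.
Proof. by move=> BC; rewrite !size_mset_sum; apply: leq_sum. Qed.

(** If [C] is larger than [A], all of [A] is paired; otherwise both sides are
    lower rows of exchanges, and [low_mono] applies. *)
Lemma paired_lower_mono A B C : (forall i, B i <= C i) ->
  forall i, paired_lower A B i <= paired_lower A C i.
Proof.
move=> BC i; have [hC|hC] := leqP (size A) (size C).
  by rewrite (paired_lower_ge hC) paired_lowerE leq_subr.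
have hB := leq_trans (leq_size_msubset BC) (ltnW hC).
by rewrite -!low_le ?(ltnW hC) // low_mono.
Qed.

Lemma unpaired_upper_mono A B C : (forall i, B i <= C i) ->
  forall i, unpaired_upper A B i <= unpaired_upper A C i.
Proof.
move=> BC i; have [hB|hB] := leqP (size B) (size A).
  by rewrite unpaired_upper_le0 // mset0E.
have hC := leq_trans (ltnW hB) (leq_size_msubset BC).
by have := low_mono A BC i; rewrite !low_ge ?(ltnW hB) // !msetE2 leq_add2l.
Qed.

(** Exchange with a larger row keeps all of [D] and adds unpaired particles,
    exchange with a smaller row keeps the paired part of [D]; so the three cases
    of the insertion are one formula. *)
Lemma insert_pairing D U k : (forall m, size (U m.+1) <= size (U m)) ->
  insert D U k = (if k is k'.+1 then paired_lower D (U k') else D) `+` unpaired_upper D (U k).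
Proof.
have msetD0 X : X `+` mset0 = X :> {mset 'I_n} by apply/msetP => i; rewrite msetE2 mset0E addn0.
elim: k U => [|k IH] U hU /=; case: (leqP (size D) (size (U 0))) => hD.
- by rewrite low_ge.
- by rewrite unpaired_upper_le0 ?msetD0 // ltnW.
- rewrite IH //; case: k {IH} => // .
  by rewrite paired_lower_ge.
have hk m : size (U m) <= size D.
  by elim: m => [|m IHm]; [apply: ltnW|apply: leq_trans IHm].
by rewrite low_le // unpaired_upper_le0 ?msetD0.
Qed.

End Insertion.

(** * Row operators in terms of levels *)

Section Levels.
Variable n' : nat.
Local Notation n := n'.+1.
Implicit Types (D : {mset 'I_n}) (u v : mword n) (i j : 'I_n).

Lemma levelE u r j : level u r j = count (leq r) (u j).
Proof.
rewrite /level mset_seqE count_flatten -map_comp sumnE big_map big_enum /= (bigD1 j) //= big1.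
  by rewrite count_nseq /= eqxx mul1n addn0.
by move=> i /negPf ne; rewrite count_nseq /= ne mul0n.
Qed.

Lemma level_mono u r r' : r <= r' -> forall j, level u r' j <= level u r j.
Proof.
by move=> rr' j; rewrite !levelE; apply: sub_count => x /=; apply: leq_trans.
Qed.

Lemma level_inj u v : (forall r, level u r = level v r) -> u = v.
Proof.
move=> e; apply/ffunP => j; apply/msetP => x.
have cE (s : seq nat) : count_mem x s = count (leq x) s - count (leq x.+1) s.
  elim: s => //= y s ->.
  have : count (leq x.+1) s <= count (leq x) s by apply: sub_count => z /=; apply: ltnW.
  by rewrite eq_sym; case: (ltngtP x y) => _; lia.
by rewrite -!count_mem_mset !cE -!levelE !e.
Qed.

Lemma count_msetD (p : pred nat) (X Y : {mset nat}) : count p (X `+` Y) = count p X + count p Y.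
Proof.
rewrite -count_cat; apply/permP.
apply/allP => x _ /=; rewrite count_cat !count_mem_mset msetE2; exact: eqxx.
Qed.

Lemma count_msetn (p : pred nat) m x : count p (msetn m x) = p x * m.
Proof. by rewrite enum_msetn count_nseq. Qed.

Lemma count_big_msetD (p : pred nat) (s : seq nat) F :
  count p (\big[msetD/mset0]_(x <- s) F x : {mset nat}) = \sum_(x <- s) count p (F x).
Proof.
elim: s => [|x s IH]; first by rewrite !big_nil enum_mset0.
by rewrite !big_cons count_msetD IH.
Qed.

(** The differences over the layers above [r] telescope.  The order of [r] and [s]
    decides where the sum really starts, whence the maximum. *)
Lemma sum_telescope (P : nat -> nat) s e r : (forall q, P q.+1 <= P q) -> P e = 0 ->
  \sum_(s <= q < e) (r <= q) * (P q - P q.+1) = P (maxn r s).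
Proof.
move=> Pd Pe.
have Pmono q d : P (q + d) <= P q.
  by elim: d => [|d IH]; rewrite ?addn0 // addnS; apply: leq_trans IH.
move: {2}(e - s) (erefl (e - s)) => d; elim: d s => [|d IH] s eq.
  rewrite big_geq; last by lia.
  by have := Pmono e (maxn r s - e); rewrite subnKC ?Pe; lia.
rewrite big_ltn ?IH; try lia.
have := Pd s; case: (leqP r s) => h; last first.
  have -> : maxn r s.+1 = r by lia.
  lia.
have -> : maxn r s.+1 = s.+1 by lia.
lia.
Qed.

(** All letters of [u] are at least [l], expressed on levels. *)
Definition bounded_below l u := forall r, r <= l -> level u r = level u l.

Lemma mem_letters u j x : x \in enum_mset (u j) -> x \in letters u.
Proof.
by move=> xu; apply/flattenP; exists (enum_mset (u j)) => //; apply: map_f; rewrite mem_enum.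
Qed.

Lemma lettersP u x : x \in letters u -> exists j, x \in enum_mset (u j).
Proof. by case/flattenP => s /mapP[j _ ->]; exists j. Qed.

Lemma letter_le_max u x : x \in letters u -> x <= max_letter u.
Proof. by move=> xu; rewrite /max_letter (leq_bigmax_seq (F := id)). Qed.

Lemma min_letter_le u x : x \in letters u -> min_letter u <= x.
Proof.
rewrite /min_letter; elim: (letters u) => // y s IH; rewrite inE big_cons geq_min.
by case/predU1P => [->|/IH ->]; rewrite ?leqnn ?orbT.
Qed.

Lemma letters_bounded l u x : bounded_below l u -> x \in letters u -> l <= x.
Proof.
move=> hu /lettersP[j xj]; have := congr1 (fun X : {mset 'I_n} => X j) (hu 0 isT).
rewrite /= !levelE (eq_count (a2 := predT)) // count_predT => e.
have /allP -> // : all (leq l) (u j) by rewrite all_count -e.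
Qed.

Lemma letters_nonempty u : u != empty_word n -> exists x, x \in letters u.
Proof.
move=> ne; case E : (letters u) => [|x s]; last by exists x; rewrite inE eqxx.
case/eqP: ne; apply/ffunP => j; rewrite ffunE; apply/msetP => x; rewrite mset0E.
apply/mset_eq0P/negP => xj; suff : x \in letters u by rewrite E.
exact: mem_letters xj.
Qed.

Lemma bigmaxn_cases a (P : pred nat) (s : seq nat) :
  let m := \big[maxn/a]_(r <- s | P r) r in
  (m = a \/ (m \in s) && P m) /\ (forall r, r \in s -> P r -> r <= m) /\ a <= m.
Proof.
elim: s => [|x s [IH1 [IH2 IH3]]] /=; first by rewrite big_nil; split; [left|].
rewrite big_cons; set m := \big[_/_]_(_ <- s | _) _ in IH1 IH2 IH3 *.
case: ifP => Px; last first.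
  split; [|split=> //].
    by case: IH1 => [|/andP[h1 h2]]; [left|right; rewrite inE h1 orbT].
  by move=> r; rewrite inE => /predU1P[->|/IH2 //]; rewrite Px.
split; [|split; last by rewrite leq_max IH3 orbT].
  rewrite /maxn; case: ifP => _; last by right; rewrite inE eqxx.
  by case: IH1 => [|/andP[h1 h2]]; [left|right; rewrite inE h1 orbT].
by move=> r; rewrite inE leq_max => /predU1P[-> _|/IH2 h /h ->]; rewrite ?leqnn ?orbT.
Qed.

Lemma level_empty r : level (empty_word n) r = mset0.
Proof. by apply/msetP => j; rewrite levelE ffunE enum_mset0 mset0E. Qed.

Lemma paired_lower0 D : paired_lower D mset0 = mset0.
Proof.
rewrite -low_le ?size_mset0 //; apply/msetP => i; rewrite mset0E.
by apply: size_eq0; rewrite size_low size_mset0.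
Qed.

Lemma unpaired_upper_mset0 D : unpaired_upper D mset0 = mset0.
Proof. by apply: unpaired_upper_le0; rewrite size_mset0. Qed.

(** Counting letters at least [r] makes both phases telescope.  The pairing phase
    gives the particles of [D] paired at level [max r s], the collapsing phase
    the unpaired particles of level [r + 1].  Below [s] nothing is lost by
    writing [r] for [max r s]: if level [s] is at least as large as [D], all of
    [D] is paired from there down, and otherwise [s] is the smallest letter. *)
Lemma level_row_op l D u : bounded_below l.+1 u -> forall r,
  level (row_op l D u) r =
    (if r <= l then D else paired_lower D (level u r)) `+` unpaired_upper D (level u (maxn r l).+1).
Proof.
move=> hu r; apply/msetP => j; rewrite levelE msetE2 /row_op.
case: eqVneq => [->|ne].
  rewrite ffunE count_msetn !level_empty paired_lower0 unpaired_upper_mset0 mset0E addn0.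
  by case: leqP; rewrite ?mset0E ?mul1n.
set a := min_letter u; set K := max_letter u; set s := \big[maxn/a]_(_ <= _ < _ | _) _.
have [x0 x0u] := letters_nonempty ne.
have la : l < a.
  rewrite /a /min_letter big_seq; elim/big_rec: _ => [|x m xu lm].
    by apply: leq_trans (letter_le_max x0u); apply: letters_bounded x0u.
  by rewrite leq_min lm andbT; apply: letters_bounded xu.
have levela q : q <= a -> level u q = level u a.
  move=> qa; apply/msetP => i; rewrite !levelE; apply: eq_in_count => x xi.
  have ax := min_letter_le (mem_letters xi).
  by rewrite ax (leq_trans qa ax).
have levelK q : K < q -> level u q = mset0.
  move=> Kq; apply/msetP => i; rewrite levelE mset0E; apply/eqP; rewrite -leqn0 leqNgt -has_count.
  by apply/hasPn => x xi /=; rewrite -ltnNge (leq_ltn_trans _ Kq) // letter_le_max // (mem_letters xi).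
have aK : a <= K := leq_trans (min_letter_le x0u) (letter_le_max x0u).
have [s_or [s_max as_]] := bigmaxn_cases a (fun q => size D <= size (level u q)) (index_iota a K.+1).
rewrite -/s in s_or s_max as_.
pose P q := paired_lower D (level u q) j; pose Q q := unpaired_upper D (level u q) j.
have Pd q : P q.+1 <= P q by apply: paired_lower_mono => i; apply: level_mono.
have Qd q : Q q.+1 <= Q q by apply: unpaired_upper_mono => i; apply: level_mono.
have PK : P K.+1 = 0 by rewrite /P levelK // paired_lower0 mset0E.
have Qs : Q s.+1 = 0.
  rewrite /Q; have [sK|Ks] := ltnP s K; last by rewrite levelK // unpaired_upper_mset0 mset0E.
  rewrite unpaired_upper0 // ltnW // ltnNge; apply/negP => h.
  suff : s.+1 <= s by rewrite ltnn.
  by apply: s_max h; rewrite mem_index_iota ltnS sK andbT leqW.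
rewrite ffunE !count_msetD !count_big_msetD count_msetn.
have -> : \sum_(s <= q < K.+1) count (leq r) (msetn (P q - P q.+1) q) = P (maxn r s).
  by rewrite -(sum_telescope _ _ Pd PK); apply: eq_bigr => q _; rewrite count_msetn.
have -> : \sum_(a <= q < s.+1) count (leq r) (msetn (Q q - Q q.+1) q.-1) = Q (maxn r.+1 a).
  rewrite -(sum_telescope _ _ Qd Qs) big_nat [RHS]big_nat; apply: eq_bigr => q /andP[aq _].
  by rewrite count_msetn /=; congr (_ * _); congr nat_of_bool; lia.
have [rl|lr] := leqP r l.
  have -> : maxn r s = s by lia.
  have -> : maxn r.+1 a = a by lia.
  by rewrite (levela l.+1) // /= mul1n /P paired_lowerE subnK ?unpaired_lower_le.
rewrite /= mul0n addn0; congr addn.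
  have [sr|rs] := leqP s r; first by [].
  rewrite -/(P r).
  (* Either s is the smallest letter, so that the levels r and s agree, or all of D
     is paired at both levels. *)
  case: s_or => [sa|/andP[_ hD]]; first by rewrite /P (levela r) -sa // ltnW.
  rewrite /P !paired_lower_ge // (leq_trans hD) //.
  by apply: leq_size_msubset; apply: level_mono; apply: ltnW.
rewrite -/(Q r.+1); have [ar|ra] := leqP a r.+1; first by [].
by rewrite /Q -(levela r.+1) // ltnW.
Qed.

Lemma bounded_row_op l D u : bounded_below l.+1 u -> bounded_below l (row_op l D u).
Proof.
by move=> hu r rl; rewrite !level_row_op // rl leqnn maxnn (maxn_idPr rl).
Qed.

Lemma level_row_op_insert l D u : bounded_below l.+1 u -> forall k,
  level (row_op l D u) (l + k) = insert D (fun m => level u (l.+1 + m)) k.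
Proof.
move=> hu k; rewrite level_row_op // insert_pairing; last first.
  by move=> m; apply: leq_size_msubset; apply: level_mono; rewrite addnS.
rewrite (maxn_idPl (leq_addr k l)) addSn; case: k => [|k]; first by rewrite addn0 leqnn.
by rewrite addnS leqNgt ltnS leq_addr.
Qed.

(** At the levels from [l] on, both sides are iterated insertions into the levels of
    [u], starting at [l + 2]; the lower levels repeat level [l]. *)
Lemma row_op_swap l A B u : bounded_below l.+2 u ->
  row_op l (low A B) (row_op l.+1 (up A B) u) = row_op l A (row_op l.+1 B u).
Proof.
move=> hu; apply: level_inj => r.
have E X Y k : level (row_op l X (row_op l.+1 Y u)) (l + k) =
    insert X (insert Y (fun m => level u (l.+2 + m))) k.
  rewrite level_row_op_insert; last exact: bounded_row_op.
  by apply: eq_insert => m; rewrite level_row_op_insert.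
have hb X Y : bounded_below l (row_op l X (row_op l.+1 Y u)).
  by do 2!apply: bounded_row_op.
have El k : level (row_op l (low A B) (row_op l.+1 (up A B) u)) (l + k) =
    level (row_op l A (row_op l.+1 B u)) (l + k).
  exact: etrans (E _ _ _) (etrans (esym (insert_exchange _ _ _ _)) (esym (E _ _ _))).
have [lr|/ltnW rl] := leqP l r; first by rewrite -(subnKC lr); exact: El.
have := El 0; rewrite addn0 => El0.
exact: etrans (hb _ _ _ rl) (etrans El0 (esym (hb _ _ _ rl))).
Qed.

Definition Phi_from l (s : seq {mset 'I_n}) : mword n :=
  foldr (fun lD u => row_op lD.1 lD.2 u) (empty_word n) (zip (iota l (size s)) s).

Lemma Phi_from_cons l D s : Phi_from l (D :: s) = row_op l D (Phi_from l.+1 s).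
Proof. by []. Qed.

Lemma bounded_Phi_from l s : bounded_below l (Phi_from l s).
Proof.
elim: s l => [|D s IH] l; first by move=> r _; rewrite !level_empty.
by rewrite Phi_from_cons; apply: bounded_row_op.
Qed.

Lemma Phi_from_swap l s1 A B s2 :
  Phi_from l (s1 ++ low A B :: up A B :: s2) = Phi_from l (s1 ++ A :: B :: s2).
Proof.
elim: s1 l => [|D s1 IH] l.
  by rewrite !cat0s !Phi_from_cons row_op_swap //; apply: bounded_Phi_from.
by rewrite !cat_cons !Phi_from_cons IH.
Qed.

Lemma sigma_split L (D : bmlq n L) (i : nat) : 0 < i < L -> exists s1 A B s2,
  D = s1 ++ A :: B :: s2 :> seq _ /\ sigma i D = s1 ++ low A B :: up A B :: s2 :> seq _.
Proof.
case: i => [//|i /andP[_ iL]].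
have sD : size D = L := size_tuple D.
exists (take i D), (nth mset0 D i), (nth mset0 D i.+1), (drop i.+2 D).
have eD : take i D ++ nth mset0 D i :: nth mset0 D i.+1 :: drop i.+2 D = D.
  by rewrite -(drop_nth mset0) ?sD // -(drop_nth mset0) ?sD ?(ltnW iL) // cat_take_drop.
split=> //; apply: (@eq_from_nth _ mset0).
  by rewrite [LHS]size_tuple -[LHS]sD -[in LHS]eD !size_cat.
move=> k; rewrite size_tuple => kL.
rewrite -[k in LHS]/(val (Ordinal kL)) /sigma nth_mktuple (tnth_nth mset0) /=.
rewrite nth_cat size_takel ?sD ?(ltnW (ltnW iL)) // !eqSS.
case: (ltngtP k i) => [ki|ik|->]; last by rewrite subnn.
  by rewrite nth_take // eqn_leq [i < k]ltnNge (ltnW ki) andbF.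
rewrite -(subnKC ik) addSn subSn ?leq_addr // addKn.
case: (k - i.+1) => [|m] /=; first by rewrite addn0 eqxx.
have -> : (i.+1 + m.+1 == i.+1) = false by lia.
by rewrite nth_drop addSnnS.
Qed.

End Levels.

Theorem corollary4p17 (n : nat) (hn : 1 <= n) (L : nat) (alpha : L.-tuple nat)
  (D : bmlq n L) (hD : has_type alpha D) (i : nat) (hi : 1 <= i < L) :
  Phi (sigma i D) = Phi D.
Proof.
case: n hn D hD => // n _ D _.
have PhiE (E : bmlq n.+1 L) : Phi E = Phi_from 1 E by rewrite /Phi_from size_tuple.
have [s1 [A [B [s2 [eD esD]]]]] := sigma_split D hi.
by rewrite !PhiE esD eD Phi_from_swap.
Qed.
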